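(* Let $A$ be a complete commutative local ring with maximal ideal $\mathfrak r$, in which $2$ is a unit, with an involution $*$. Let $V$ be a free $A$-module of finite rank $m>0$, let $\varepsilon\in\{1,-1\}$, and let $h$ and $h'$ be nondegenerate $\varepsilon$-hermitian forms on $V$. Then $h$ and $h'$ are equivalent if and only if the forms $h_0$ and $h'_0$ over $A/\mathfrak r$ are equivalent. In particular, if $*$ is ramified and $h$ and $h'$ are skew hermitian, then $h$ and $h'$ are equivalent.
   Context: An involution of $A$ is a ring automorphism $a\mapsto a^*$ of order at most two (the identity is allowed); it induces an involution on $A/\mathfrak r$, also denoted $*$. It is ramified if $\{a\in A:a^*=-a\}\subset\mathfrak r$ (equivalently, the induced involution on $A/\mathfrak r$ is trivial). Complete means that $\bigcap_{i\ge1}\mathfrak r^i=0$ and $A$ is complete for its $\mathfrak r$-adic metric. A map $h:V\times V\to A$ is an $\varepsilon$-hermitian form if it is bi-additive, $A$-linear in the second variable, and $h(v,u)=\varepsilon h(u,v)^*$ for all $u,v$; skew hermitian means $\varepsilon=-1$. It is nondegenerate if the Gram matrix $(h(v_i,v_j))$ of any basis $v_1,\dots,v_m$ of $V$ belongs to $GL_m(A)$. For such $h$, let $V(1)=\{v\in V:h(V,v)\subset\mathfrak r\}$; then $h_0:V/V(1)\times V/V(1)\to A/\mathfrak r$ is the $\varepsilon$-hermitian form over $A/\mathfrak r$ induced by $h$, i.e. $h_0(u+V(1),v+V(1))=h(u,v)+\mathfrak r$. The form $h'_0$ is defined in the same way from $h'$. Two forms $h_1$ on $V_1$ and $h_2$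 on $V_2$ (over the same ring) are equivalent if there is a linear isomorphism $\varphi:V_1\to V_2$ with $h_1(u,v)=h_2(\varphi(u),\varphi(v))$ for all $u,v\in V_1$. *)

(* Defs.v *)
From HB Require Import structures.
From mathcomp Require Import all_boot all_algebra.
From mathcomp Require Import boolp.

Set Implicit Arguments.
Unset Strict Implicit.
Unset Printing Implicit Defensive.

Import GRing.Theory.
Local Open Scope ring_scope.
Local Open Scope quotient_scope.

(** * Complete local rings *)

(* An [idealr] is a proper ideal.  Its being a boolean predicate is no
   restriction, by classical logic. *)
Definition maximal_ideal (A : comNzRingType) (I : idealr A) : Prop :=
  forall J : idealr A, {subset I <= J} -> J =i I.

Definition local_ring (A : comNzRingType) (r : idealr A) : Prop :=
  maximal_ideal r /\ forall J : idealr A, maximal_ideal J -> J =i r.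

Fixpoint ideal_pow (A : comNzRingType) (I : {pred A}) (n : nat) : A -> Prop :=
  match n with
  | 0 => fun=> True
  | n'.+1 => fun x => exists (k : nat) (a b : 'I_k -> A),
      [/\ forall i, a i \in I, forall i, ideal_pow I n' (b i)
        & x = \sum_(i < k) a i * b i]
  end.

Definition adic_cauchy (A : comNzRingType) (I : {pred A}) (u : nat -> A) : Prop :=
  forall n, exists N, forall i j,
    (N <= i)%N -> (N <= j)%N -> ideal_pow I n (u i - u j).

Definition adic_cvg (A : comNzRingType) (I : {pred A}) (u : nat -> A) (l : A) : Prop :=
  forall n, exists N, forall i, (N <= i)%N -> ideal_pow I n (u i - l).

Definition adic_complete (A : comNzRingType) (I : {pred A}) : Prop :=
  (forall x : A, (forall i, (1 <= i)%N -> ideal_pow I i x) -> x = 0) /\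
  (forall u : nat -> A, adic_cauchy I u -> exists l, adic_cvg I u l).

Definition ramified (A : comNzRingType) (r : {pred A}) (star : A -> A) : Prop :=
  forall a : A, star a = - a -> a \in r.

(** * Hermitian forms *)

(* The library's [{hermitian V for eps & theta}] is linear in the first
   variable, whereas the forms considered here are linear in the second. *)
Record eps_hermitian (A : comNzRingType) (star : A -> A) (eps : A)
    (V : lmodType A) (h : V -> V -> A) : Prop := EpsHermitian {
  hermDl : forall u u' v, h (u + u') v = h u v + h u' v;
  hermDr : forall u v v', h u (v + v') = h u v + h u v';
  hermZr : forall a u v, h u (a *: v) = h u v * a;
  hermC  : forall u v, h v u = eps * star (h u v)
}.

Record herm_form (A : comNzRingType) (star : A -> A) (eps : A)
    (V : lmodType A) := HermForm {
  herm_fun :> V -> V -> A;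
  hermP : eps_hermitian star eps herm_fun
}.

Definition equivalent_forms (A : comNzRingType) (V1 V2 : lmodType A)
    (h1 : V1 -> V1 -> A) (h2 : V2 -> V2 -> A) : Prop :=
  exists2 phi : {linear V1 -> V2}, bijective phi &
    forall u v, h1 u v = h2 (phi u) (phi v).

Definition is_basis (A : comNzRingType) (V : lmodType A) (m : nat)
    (e : 'I_m -> V) : Prop :=
  forall v : V, exists! a : 'rV[A]_m, v = \sum_(i < m) a 0 i *: e i.

Definition gram (A : comNzRingType) (V : lmodType A) (h : V -> V -> A) (m : nat)
    (e : 'I_m -> V) : 'M[A]_m := \matrix_(i, j) h (e i) (e j).

(* [dim V] is the rank of the free module [V]. *)
Definition nondegenerate_form (A : comUnitRingType) (V : vectType A)
    (h : V -> V -> A) : Prop :=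
  forall e : 'I_(dim V) -> V, is_basis e -> gram h e \in unitmx.

(** * Reduction modulo an ideal *)

Section Reduction.
Variables (A : comNzRingType) (r : idealr A) (star : A -> A) (eps : A).
Variables (V : lmodType A) (h : herm_form star eps V).

(* V(1) *)
Definition red_ker : {pred V} := fun v => `[< forall u, h u v \in r >].

Lemma red_kerP v : reflect (forall u, h u v \in r) (v \in red_ker).
Proof. exact: asboolP. Qed.

Lemma red_kerB : zmod_closed red_ker.
Proof.
have h0 u : h u 0 = 0 by rewrite -(scale0r 0) (hermZr (hermP h)) mulr0.
split=> [|v w /red_kerP hv /red_kerP hw]; apply/red_kerP=> u.
  by rewrite h0 rpred0.
by rewrite -scaleN1r (hermDr (hermP h)) (hermZr (hermP h)) mulrN1 rpredB.
Qed.

HB.instance Definition _ := GRing.isZmodClosed.Build V red_ker red_kerB.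

Lemma red_kerZ a v : v \in red_ker -> a *: v \in red_ker.
Proof.
move=> /red_kerP hv; apply/red_kerP=> u.
by rewrite (hermZr (hermP h)) mulrC idealMr.
Qed.

Lemma red_ker_ideal a v : a \in r -> a *: v \in red_ker.
Proof.
move=> ra; apply/red_kerP=> u.
by rewrite (hermZr (hermP h)) idealMr.
Qed.

(* V / V(1), as a module over A / r *)
Definition red_mod := {ideal_quot red_ker}.
HB.instance Definition _ := Choice.on red_mod.
HB.instance Definition _ := ZmodQuotient.on red_mod.
HB.instance Definition _ := GRing.Zmodule.on red_mod.

Definition red_scale (a : {ideal_quot r}) (x : red_mod) : red_mod :=
  \pi_(red_mod) (repr a *: repr x).

Lemma red_scale_pi a v :
  red_scale (\pi_({ideal_quot r}) a) (\pi_(red_mod) v)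
  = \pi_(red_mod) (a *: v).
Proof.
apply/eqP; rewrite /red_scale -Quotient.idealrBE.
set b := repr _; set w := repr _.
have rab : b - a \in r by rewrite Quotient.idealrBE reprK.
have kvw : w - v \in red_ker by rewrite Quotient.idealrBE reprK.
have -> : b *: w - a *: v = (b - a) *: w + a *: (w - v).
  by rewrite scalerBl scalerBr addrA subrK.
by apply: rpredD; [exact: red_ker_ideal | exact: red_kerZ].
Qed.

Fact red_scaleA a b x : red_scale a (red_scale b x) = red_scale (a * b) x.
Proof.
rewrite -[a]reprK -[b]reprK -[x]reprK -rmorphM.
by rewrite /= (red_scale_pi (repr b)) !red_scale_pi scalerA.
Qed.

Fact red_scale1 : left_id 1 red_scale.
Proof.
by move=> x; rewrite -[x]reprK -(rmorph1 (\pi_({ideal_quot r}))) /= red_scale_pi scale1r.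
Qed.

Fact red_scaleDr : right_distributive red_scale +%R.
Proof.
move=> a x y; rewrite -[a]reprK -[x]reprK -[y]reprK -raddfD.
by rewrite /= !red_scale_pi scalerDr raddfD.
Qed.

Fact red_scaleDl x : {morph red_scale^~ x : a b / a + b}.
Proof.
move=> a b /=; rewrite -[a]reprK -[b]reprK -[x]reprK -raddfD.
by rewrite /= !red_scale_pi scalerDl raddfD.
Qed.

HB.instance Definition _ := GRing.Zmodule_isLmodule.Build {ideal_quot r} red_mod
  red_scaleA red_scale1 red_scaleDr red_scaleDl.

Definition red_pi (v : V) : red_mod := \pi_(red_mod) v.

(* h_0; see [red_formE] for independence of the representatives *)
Definition red_form (x y : red_mod) : {ideal_quot r} :=
  \pi_({ideal_quot r}) (h (repr x) (repr y)).

Definition red_star (a : {ideal_quot r}) : {ideal_quot r} :=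
  \pi_({ideal_quot r}) (star (repr a)).

End Reduction.

Arguments red_mod {A} r {star eps V} h.
Arguments red_pi {A} r {star eps V} h v.
Arguments red_form {A} r {star eps V} h x y.
Arguments red_star {A} r star a.

(** Well-definedness of the induced involution and of [h_0] *)

Section ReductionTheory.
Variables (A : comNzRingType) (star : involutive_rmorphism A).

Definition star_preim (J : idealr A) : {pred A} := fun a => star a \in J.

Fact star_preim_idealr (J : idealr A) : idealr_closed (star_preim J).
Proof.
split=> [||a u v].
- by rewrite -[_ \in _]/(star 0 \in J) rmorph0 rpred0.
- by rewrite -[_ \in _]/(star 1 \in J) rmorph1 idealr1.
move=> ru rv; rewrite -[_ \in _]/(star (a * u + v) \in J) rmorphD rmorphM.
by rewrite rpredD ?idealMr.
Qed.

HB.instance Definition _ (J : idealr A) :=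
  isIdealr.Build A (star_preim J) (star_preim_idealr J).

Lemma star_preimE (J : idealr A) a : (a \in star_preim J) = (star a \in J).
Proof. by []. Qed.

Variables (r : idealr A) (r_local : local_ring r).

Lemma star_local a : (star a \in r) = (a \in r).
Proof.
rewrite -star_preimE; apply: (r_local.2 (star_preim r)) => J rJ b.
have eJ : star_preim J =i r.
  apply: (r_local.1 (star_preim J)) => c rc.
  by rewrite star_preimE rJ // star_preimE rmorphK.
by rewrite -[b in LHS](rmorphK star) -star_preimE eJ -star_preimE.
Qed.

Lemma red_starE a :
  red_star r star (\pi_({ideal_quot r}) a) = \pi_({ideal_quot r}) (star a).
Proof.
apply/eqP; rewrite /red_star -Quotient.idealrBE -rmorphB star_local.
by rewrite Quotient.idealrBE reprK.
Qed.

Variables (eps : A) (V : lmodType A) (h : herm_form star eps V).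

Lemma red_formE u v :
  red_form r h (red_pi r h u) (red_pi r h v) = \pi_({ideal_quot r}) (h u v).
Proof.
apply/eqP; rewrite /red_form -Quotient.idealrBE.
set u' := repr _; set v' := repr _.
have ku : u' - u \in red_ker r h by rewrite Quotient.idealrBE reprK.
have kv : v' - v \in red_ker r h by rewrite Quotient.idealrBE reprK.
have -> : h u' v' - h u v = h (u' - u) v' + h u (v' - v).
  rewrite -[u' in LHS](subrK u) -[v' in h (_ + _) v'](subrK v).
  rewrite (hermDl (hermP h)) !(hermDr (hermP h) u) subrK.
  by rewrite addrA addrK.
apply: rpredD; last by move/red_kerP: kv.
by rewrite (hermC (hermP h)) idealMr // star_local; move/red_kerP: ku.
Qed.

Lemma red_form_hermitian :
  eps_hermitian (red_star r star) (\pi_({ideal_quot r}) eps)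
    (red_form r h).
Proof.
split=> [u u' v|u v v'|a u v|u v].
- rewrite -[u]reprK -[u']reprK -[v]reprK -raddfD !red_formE.
  by rewrite (hermDl (hermP h)) raddfD.
- rewrite -[u]reprK -[v']reprK -[v]reprK -raddfD !red_formE.
  by rewrite (hermDr (hermP h)) raddfD.
- rewrite -[a]reprK -[u]reprK -[v]reprK.
  rewrite -[_ *: _]/(red_scale _ _) red_scale_pi !red_formE.
  by rewrite (hermZr (hermP h)) rmorphM.
rewrite -[u]reprK -[v]reprK !red_formE red_starE -rmorphM.
by rewrite (hermC (hermP h)).
Qed.

End ReductionTheory.

(* Main.v *)
From HB Require Import structures.
Require Import Defs.
From mathcomp Require Import all_boot fingroup perm all_algebra generic_quotient.
From mathcomp Require Import boolp ring.

Set Implicit Arguments.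
Unset Strict Implicit.
Unset Printing Implicit Defensive.

Import GRing.Theory VectorInternalTheory.
Local Open Scope ring_scope.

(** In coordinates, [h] and [h'] are equivalent iff their Gram matrices satisfy
    [H = X^* H' X] for some invertible [X], where [X^*] is the conjugate
    transpose.  An equivalence of [h_0] and [h'_0] lifts to an [X] with
    [E = H - X^* H' X] zero modulo [r], and Newton's iteration
    [X + (X^* H')^-1 (E / 2)] turns it into an exact solution: as [E^* = eps E],
    the two linear terms each contribute [E / 2], and the new error is
    quadratic in [E].  In the ramified skew case all diagonal entries of the
    Gram matrices lie in [r], so splitting off blocks congruent to
    [[0, 1], [-1, 0]] shows that any two of them are congruent modulo [r]. *)

(** * Powers of an ideal and limits in the adic topology *)

Section IdealPowers.
Variables (A : comNzRingType) (r : idealr A).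

Lemma ideal_pow0 n : ideal_pow r n 0.
Proof.
case: n => [//|n]; exists 0, (fun=> 0), (fun=> 0).
by split=> [[]|[]|] //; rewrite big_ord0.
Qed.

(** Two finite sums of products are concatenated into one, indexed by ['I_(k + l)]. *)
Lemma ideal_powD n x y :
  ideal_pow r n x -> ideal_pow r n y -> ideal_pow r n (x + y).
Proof.
case: n => [//|n] [k [a [b [ha hb ->]]]] [l [c [d [hc hd ->]]]].
exists (k + l)%N, (fun i => match split i with inl j => a j | inr j => c j end),
  (fun i => match split i with inl j => b j | inr j => d j end).
split=> [i|i|]; [by case: split | by case: split |].
rewrite big_split_ord /=; congr (_ + _); apply: eq_bigr => i _.
  by rewrite (unsplitK (inl i : 'I_k + 'I_l)).
by rewrite (unsplitK (inr i : 'I_k + 'I_l)).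
Qed.

Lemma ideal_pow_sum n (I : finType) (F : I -> A) :
  (forall i, ideal_pow r n (F i)) -> ideal_pow r n (\sum_i F i).
Proof.
move=> hF; elim/big_ind: _ => [|x y|//]; first exact: ideal_pow0.
exact: ideal_powD.
Qed.

Lemma ideal_powMl n a x : ideal_pow r n x -> ideal_pow r n (a * x).
Proof.
case: n => [//|n] /= [k [u [v [hu hv ->]]]].
exists k, (fun i => a * u i), v; split=> // [i|]; first exact: idealMr.
by rewrite mulr_sumr; apply: eq_bigr => i _; rewrite mulrA.
Qed.

Lemma ideal_powMr n a x : ideal_pow r n x -> ideal_pow r n (x * a).
Proof. by rewrite mulrC; apply: ideal_powMl. Qed.

Lemma ideal_powN n x : ideal_pow r n x -> ideal_pow r n (- x).
Proof. by rewrite -mulN1r; apply: ideal_powMl. Qed.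

Lemma ideal_powB n x y :
  ideal_pow r n x -> ideal_pow r n y -> ideal_pow r n (x - y).
Proof. by move=> hx hy; apply/ideal_powD/ideal_powN. Qed.

Lemma ideal_powS n x y : x \in r -> ideal_pow r n y -> ideal_pow r n.+1 (x * y).
Proof.
move=> rx hy; exists 1, (fun=> x), (fun=> y).
by split=> //; rewrite big_ord1.
Qed.

Lemma ideal_pow_le m n x : (m <= n)%N -> ideal_pow r n x -> ideal_pow r m x.
Proof.
elim: m n x => [//|m IH] [//|n] x /= lemn [k [u [v [hu hv ->]]]].
by exists k, u, v; split=> // i; apply: IH (hv i).
Qed.

Lemma ideal_pow1 x : ideal_pow r 1 x <-> x \in r.
Proof.
split=> [[k [u [v [hu _ ->]]]]|rx]; last by rewrite -[x]mulr1; apply: ideal_powS.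
by apply: rpred_sum => i _; rewrite mulrC idealMr.
Qed.

Lemma ideal_powXn n x : x \in r -> ideal_pow r n (x ^+ n).
Proof. by move=> rx; elim: n => // n IH; rewrite exprS; apply: ideal_powS. Qed.

(** One factor is only used as an element of r. This gain of a single exponent is all that the
    convergence of Newton's iteration requires. *)
Lemma ideal_powM n x y :
  ideal_pow r n.+1 x -> ideal_pow r n.+1 y -> ideal_pow r n.+2 (x * y).
Proof. by move=> /(ideal_pow_le (isT : 1 <= n.+1)%N)/ideal_pow1; apply: ideal_powS. Qed.

Lemma ideal_pow_star (star : {rmorphism A -> A}) n x :
  (forall a, a \in r -> star a \in r) -> ideal_pow r n x -> ideal_pow r n (star x).
Proof.
move=> hs; elim: n x => [//|n IH] x [k [u [v [hu hv ->]]]].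
rewrite rmorph_sum; apply: (ideal_pow_sum (n := n.+1)) => i; rewrite rmorphM.
exact: (ideal_powS (hs _ (hu i)) (IH _ (hv i))).
Qed.

(** Telescoping makes the sequence Cauchy with modulus n. The explicit rate for the limit follows by
    passing through a term [u (n + N)] far enough along. *)
Lemma adic_limit (u : nat -> A) : adic_complete r ->
  (forall n, ideal_pow r n (u n.+1 - u n)) ->
  exists l, forall n, ideal_pow r n (u n - l).
Proof.
move=> [_ cpl] hu.
have step n k : ideal_pow r n (u (n + k)%N - u n).
  elim: k => [|k IH]; first by rewrite addn0 subrr; apply: ideal_pow0.
  rewrite addnS -[u _.+1](subrK (u (n + k)%N)) -addrA; apply: ideal_powD => //.
  exact: ideal_pow_le (leq_addr k n) (hu _).
have /cpl[l lP] : adic_cauchy r u.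
  move=> n; exists n => i j /subnKC <- /subnKC <-.
  by rewrite -(subrKA (u n)) -[u n - _]opprB; apply: ideal_powB.
exists l => n; have [N /(_ _ (leq_addl n N)) hN] := lP n.
have -> : u n - l = u (n + N)%N - l - (u (n + N)%N - u n) by ring.
exact: ideal_powB.
Qed.

End IdealPowers.

(** * Matrices with entries in a power of the ideal *)

Section MatrixPowers.
Variables (A : comNzRingType) (r : idealr A).

Definition mx_ideal_pow n p q (X : 'M[A]_(p, q)) := forall i j, ideal_pow r n (X i j).

Lemma mx_ideal_powD n p q (X Y : 'M[A]_(p, q)) :
  mx_ideal_pow n X -> mx_ideal_pow n Y -> mx_ideal_pow n (X + Y).
Proof. by move=> hX hY i j; rewrite mxE; apply: ideal_powD. Qed.

Lemma mx_ideal_powN n p q (X : 'M[A]_(p, q)) :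
  mx_ideal_pow n X -> mx_ideal_pow n (- X).
Proof. by move=> hX i j; rewrite mxE; apply: ideal_powN. Qed.

Lemma mx_ideal_powZ n p q a (X : 'M[A]_(p, q)) :
  mx_ideal_pow n X -> mx_ideal_pow n (a *: X).
Proof. by move=> hX i j; rewrite mxE; apply: ideal_powMl. Qed.

Lemma mx_ideal_powMl n p q s (X : 'M[A]_(p, q)) (Y : 'M[A]_(q, s)) :
  mx_ideal_pow n Y -> mx_ideal_pow n (X *m Y).
Proof. by move=> hY i j; rewrite mxE; apply: ideal_pow_sum => k; apply: ideal_powMl. Qed.

Lemma mx_ideal_powMr n p q s (X : 'M[A]_(p, q)) (Y : 'M[A]_(q, s)) :
  mx_ideal_pow n X -> mx_ideal_pow n (X *m Y).
Proof. by move=> hX i j; rewrite mxE; apply: ideal_pow_sum => k; apply: ideal_powMr. Qed.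

Lemma mx_ideal_powM n p q s (X : 'M[A]_(p, q)) (Y : 'M[A]_(q, s)) :
  mx_ideal_pow n.+1 X -> mx_ideal_pow n.+1 Y -> mx_ideal_pow n.+2 (X *m Y).
Proof.
move=> hX hY i j; rewrite mxE.
by apply: (ideal_pow_sum (n := n.+2)) => k; apply: ideal_powM.
Qed.

Lemma mx_adic_limit p q (u : nat -> 'M[A]_(p, q)) : adic_complete r ->
  (forall n, mx_ideal_pow n (u n.+1 - u n)) ->
  exists X, forall n, mx_ideal_pow n (u n - X).
Proof.
move=> cpl hu.
have /choice[l lP] (ij : 'I_p * 'I_q) :
    exists l, forall n, ideal_pow r n (u n ij.1 ij.2 - l).
  by apply: adic_limit => // n; have := hu n ij.1 ij.2; rewrite !mxE.
by exists (\matrix_(i, j) l (i, j)) => n i j; rewrite !mxE; apply: (lP (i, j)).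
Qed.

End MatrixPowers.

(** * Units of a complete local ring *)

Section LocalUnits.
Variables (A : comUnitRingType) (r : idealr A).

(** If a had no inverse modulo r, then r + aA would not contain 1. It would be a proper ideal
    containing r, hence equal to r by maximality, although it contains a. *)
Lemma maximal_inv_mod a : maximal_ideal r -> a \notin r ->
  exists b, 1 - a * b \in r.
Proof.
move=> rmax ra; apply: contrapT => nb.
pose J : {pred A} := fun x => `[< exists b, x - a * b \in r >].
have JP x : reflect (exists b, x - a * b \in r) (x \in J) by apply: asboolP.
have Jclosed : idealr_closed J.
  split; first by apply/JP; exists 0; rewrite mulr0 subr0 rpred0.
    by apply/JP.
  move=> c u v /JP[b hb] /JP[b' hb']; apply/JP; exists (c * b + b').
  have -> : c * u + v - a * (c * b + b') = c * (u - a * b) + (v - a * b').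
    by rewrite mulrBr mulrDr opprD addrACA (mulrCA a).
  by rewrite rpredD ?idealMr.
pose HJ := isIdealr.Build A J Jclosed.
pose JJ : idealr A := HB.pack J HJ.
have rJ : {subset r <= JJ} by move=> x rx; apply/JP; exists 0; rewrite mulr0 subr0.
have := rmax JJ rJ a; rewrite (negPf ra) => /negP; apply.
by apply/JP; exists 1; rewrite mulr1 subrr rpred0.
Qed.

(** The inverse is the limit l of the geometric series: (1 - x) l - 1 lies in every power of r,
    hence vanishes. *)
Lemma adic_unit1B x : adic_complete r -> x \in r -> 1 - x \is a GRing.unit.
Proof.
move=> cpl rx; pose u n := \sum_(i < n) x ^+ i.
have [l lP] : exists l, forall n, ideal_pow r n (u n - l).
  apply: adic_limit => // n; rewrite /u big_ord_recr /= addrAC subrr add0r.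
  exact: ideal_powXn.
suff e : (1 - x) * l = 1 by apply/unitrP; exists l; rewrite mulrC e.
apply/eqP; rewrite -subr_eq0; apply/eqP/cpl.1 => n _.
have := ideal_powMl (x - 1) (lP n); rewrite mulrBr -subrX1 => hn.
have -> : (1 - x) * l - 1 = (x ^+ n - 1 - (x - 1) * l) - x ^+ n by ring.
by apply: (ideal_powB hn); apply: ideal_powXn.
Qed.

(** With b inverse to a modulo r, the product ab = 1 - (1 - ab) is a unit, and so is its factor
    a. *)
Lemma local_unit a : local_ring r -> adic_complete r -> a \notin r ->
  a \is a GRing.unit.
Proof.
move=> rloc rcpl /(maximal_inv_mod rloc.1)[b /(adic_unit1B rcpl)].
by rewrite opprB addrC subrK unitrM => /andP[].
Qed.

End LocalUnits.

(** * Conjugate transposes *)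

Section ConjTranspose.
Variables (A : comUnitRingType) (star : involutive_rmorphism A).

Definition conj_tr p q (X : 'M[A]_(p, q)) : 'M[A]_(q, p) := (map_mx star X)^T.

Local Notation "X ^H" := (conj_tr X) (at level 1, format "X ^H").

Lemma conj_trE p q (X : 'M[A]_(p, q)) i j : X^H i j = star (X j i).
Proof. by rewrite !mxE. Qed.

Lemma conj_trM p q s (X : 'M[A]_(p, q)) (Y : 'M[A]_(q, s)) :
  (X *m Y)^H = Y^H *m X^H.
Proof. by rewrite /conj_tr map_mxM trmx_mul. Qed.

Lemma conj_trD p q (X Y : 'M[A]_(p, q)) : (X + Y)^H = X^H + Y^H.
Proof. by rewrite /conj_tr map_mxD raddfD. Qed.

Lemma conj_trB p q (X Y : 'M[A]_(p, q)) : (X - Y)^H = X^H - Y^H.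
Proof. by rewrite /conj_tr map_mxB raddfB. Qed.

Lemma conj_trZ p q a (X : 'M[A]_(p, q)) : (a *: X)^H = star a *: X^H.
Proof. by rewrite /conj_tr map_mxZ linearZ. Qed.

Lemma conj_tr0 p q : (0 : 'M[A]_(p, q))^H = 0.
Proof. by rewrite /conj_tr map_mx0 trmx0. Qed.

Lemma conj_tr1 m : (1%:M : 'M[A]_m)^H = 1%:M.
Proof. by rewrite /conj_tr map_mx1 trmx1. Qed.

Lemma conj_trK p q (X : 'M[A]_(p, q)) : X^H^H = X.
Proof. by apply/matrixP => i j; rewrite !conj_trE rmorphK. Qed.

Lemma conj_tr_unit m (X : 'M[A]_m) : (X^H \in unitmx) = (X \in unitmx).
Proof.
suff imp (Y : 'M[A]_m) : Y \in unitmx -> Y^H \in unitmx.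
  by apply/idP/idP => /imp //; rewrite conj_trK.
by rewrite !unitmxE det_tr det_map_mx => /(rmorph_unit star).
Qed.

Lemma conj_tr_block p1 p2 q1 q2 (X : 'M[A]_(p1, q1)) (Y : 'M[A]_(p1, q2))
    (Z : 'M[A]_(p2, q1)) (W : 'M[A]_(p2, q2)) :
  (block_mx X Y Z W)^H = block_mx X^H Z^H Y^H W^H.
Proof. by rewrite /conj_tr map_block_mx tr_block_mx. Qed.

End ConjTranspose.

Lemma eps_sqr (A : nzRingType) (eps : A) : eps = 1 \/ eps = -1 -> eps * eps = 1.
Proof. by case=> ->; rewrite ?mulr1 // mulrNN mulr1. Qed.

(** * Lifting a congruence modulo r by Newton's iteration *)

Section Congruence.
Variables (A : comUnitRingType) (r : idealr A) (star : involutive_rmorphism A).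
Hypotheses (r_local : local_ring r) (r_complete : adic_complete r).

Local Notation "X ^H" := (conj_tr star X) (at level 1, format "X ^H").
Local Notation mx_ideal_pow := (mx_ideal_pow r).

Lemma unit_notin a : a \is a GRing.unit -> a \notin r.
Proof.
move=> ua; apply/negP => /(idealMr (a^-1)).
by rewrite mulVr // idealr1.
Qed.

Lemma unitE_local a : (a \is a GRing.unit) = (a \notin r).
Proof. by apply/idP/idP => [/unit_notin|/(local_unit r_local r_complete)]. Qed.

(** The determinants have the same image in A/r, and being a unit only depends on that image. *)
Lemma unitmx_mod m (X Y : 'M[A]_m) : mx_ideal_pow 1 (X - Y) ->
  (X \in unitmx) = (Y \in unitmx).
Proof.
move=> hXY; rewrite !unitmxE !unitE_local.
have pi0 a b : a - b \in r -> \pi_({ideal_quot r})%qT a = \pi_({ideal_quot r})%qT b.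
  by rewrite Quotient.idealrBE => /eqP.
suff : \det X - \det Y \in r.
  move=> d; congr (~~ _); apply/idP/idP => [hX|hY]; last first.
    by rewrite -(subrK (\det Y) (\det X)) rpredD.
  by rewrite -(subKr (\det X) (\det Y)) rpredB.
rewrite Quotient.idealrBE -!det_map_mx; apply/eqP; congr (\det _).
apply/matrixP => i j; rewrite !mxE; apply: pi0.
by have /ideal_pow1 := hXY i j; rewrite !mxE.
Qed.

Lemma mx_ideal_pow_conj_tr n p q (X : 'M[A]_(p, q)) :
  mx_ideal_pow n X -> mx_ideal_pow n X^H.
Proof.
move=> hX i j; rewrite conj_trE; apply: ideal_pow_star => // a.
by rewrite (star_local star r_local).
Qed.

(** This expresses congruence over A/r by matrices over A, so that [X] can serve as the starting
    point of the iteration. *)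
Definition congruent_mod m (H H' : 'M[A]_m) :=
  exists2 X, X \in unitmx & mx_ideal_pow 1 (H - X^H *m H' *m X).

Section Lifting.
Variables (eps : A) (m : nat) (H H' : 'M[A]_m).
Hypotheses (u2 : (2%:R : A) \is a GRing.unit) (epsP : eps = 1 \/ eps = -1).
Hypotheses (HH : H^H = eps *: H) (HH' : H'^H = eps *: H') (uH : H \in unitmx).

Let E X := H - X^H *m H' *m X.
Let D X := invmx (X^H *m H') *m (2%:R^-1 *: E X).

(** The product [X^H *m H' *m X] agrees with the invertible [H] modulo r, so it is invertible, and
    so are its factors. *)
Lemma newton_unit X : mx_ideal_pow 1 (E X) -> X^H *m H' \in unitmx /\ X \in unitmx.
Proof.
by move=> /unitmx_mod; rewrite uH => e; apply/andP; rewrite -unitmx_mul -e.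
Qed.

Lemma newton_error X : mx_ideal_pow 1 (E X) ->
  E (X + D X) = - ((D X)^H *m H' *m D X).
Proof.
move=> /newton_unit[uXH _].
have hD : X^H *m H' *m D X = 2%:R^-1 *: E X by rewrite mulmxA mulmxV // mul1mx.
have hE : (E X)^H = eps *: E X.
  by rewrite conj_trB !conj_trM conj_trK HH HH' -scalemxAl -scalemxAr -scalerBr mulmxA.
(* This is the conjugate transpose of [hD]: both [H'] and [E X] produce a factor [eps], which
   cancels since its square is 1. *)
have hD' : (D X)^H *m H' *m X = 2%:R^-1 *: E X.
  have := congr1 (@conj_tr _ star _ _) hD.
  rewrite conj_trZ hE !conj_trM conj_trK HH' -scalemxAl -scalemxAr rmorphV // rmorph_nat.
  rewrite [RHS]scalerA mulrC -scalerA => /(congr1 ( *:%R eps)).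
  by rewrite !(scalerA eps eps) (eps_sqr epsP) !scale1r mulmxA.
rewrite /E conj_trD !(mulmxDl, mulmxDr) hD hD'.
have -> : X^H *m H' *m X = H - E X by rewrite subKr.
have : E X = 2%:R^-1 *: E X + 2%:R^-1 *: E X.
  by rewrite -scalerDl -mulr2n -[X in X *: _](mulr_natr (2%:R^-1) 2) mulVr // scale1r.
move: (2%:R^-1 *: E X) ((D X)^H *m H' *m D X) => e d; move: (E X) => E_X ->.
by apply/matrixP => i j; rewrite !mxE; ring.
Qed.

Lemma congruent_lift : congruent_mod H H' ->
  exists2 X, X \in unitmx & H = X^H *m H' *m X.
Proof.
case=> X0 _ hX0; pose u n := iter n (fun X => X + D X) X0.
have le1 n : mx_ideal_pow n.+1 (E (u n)) -> mx_ideal_pow 1 (E (u n)).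
  by move=> h i j; apply: (@ideal_pow_le _ _ 1 n.+1).
have hDn n : mx_ideal_pow n.+1 (E (u n)) -> mx_ideal_pow n.+1 (D (u n)).
  by move=> h; apply/mx_ideal_powMl/mx_ideal_powZ.
(* The exponent is n + 1 because the initial error is already zero modulo r. The new error is
   quadratic in [D (u n)], so each step gains at least one power. *)
have hE n : mx_ideal_pow n.+1 (E (u n)).
  elim: n => [//|n IH]; rewrite [u _]iterS newton_error; last exact: le1.
  apply: (mx_ideal_powN (n := n.+2)); apply: mx_ideal_powM; last exact: hDn.
  by apply/mx_ideal_powMr/mx_ideal_pow_conj_tr/hDn.
have [n|X hX] := @mx_adic_limit _ r _ _ u r_complete.
  rewrite [u n.+1]iterS addrC addKr => i j.
  exact: ideal_pow_le (leqnSn n) (hDn n (hE n) i j).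
have EX n : mx_ideal_pow n (E X).
  (* The error of the limit is compared with that of [u n]; each remaining term has a factor
     [u n - X], up to conjugation. Hence [E X] lies in all powers of r and is zero. *)
  have -> : E X = E (u n) + ((u n - X)^H *m H' *m u n + X^H *m H' *m (u n - X)).
    rewrite conj_trB !(mulmxBl, mulmxBr); rewrite /E.
    by apply/matrixP => i j; rewrite !mxE; ring.
  apply: mx_ideal_powD; first by move=> i j; apply: ideal_pow_le (leqnSn n) (hE n i j).
  apply: mx_ideal_powD; last exact: mx_ideal_powMl.
  by apply/mx_ideal_powMr/mx_ideal_powMr/mx_ideal_pow_conj_tr.
exists X; first by have [] := newton_unit (EX 1).
apply/eqP; rewrite -subr_eq0; apply/eqP/matrixP => i j; rewrite [RHS]mxE.
by apply: r_complete.1 => n _; apply: EX.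
Qed.

End Lifting.
End Congruence.

(** * Skew hermitian matrices in the ramified case *)

Section RamifiedSkew.
Variables (A : comUnitRingType) (r : idealr A) (star : involutive_rmorphism A).
Hypotheses (r_local : local_ring r) (r_complete : adic_complete r).
Hypothesis star_ramified : ramified r star.

Local Notation "X ^H" := (conj_tr star X) (at level 1, format "X ^H").
Local Notation mx_ideal_pow := (mx_ideal_pow r).

(** Allows both matrices to be put in normal form separately: a congruence [X] between the normal
    forms is carried back as [Q *m X *m invmx P]. *)
Lemma congruent_mod_base m (H H' P Q : 'M[A]_m) : P \in unitmx -> Q \in unitmx ->
  congruent_mod r star (P^H *m H *m P) (Q^H *m H' *m Q) -> congruent_mod r star H H'.
Proof.
move=> uP uQ [X uX hX]; exists (Q *m X *m invmx P).
  by rewrite !unitmx_mul uQ uX unitmx_inv.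
have -> : H - (Q *m X *m invmx P)^H *m H' *m (Q *m X *m invmx P) =
    (invmx P)^H *m (P^H *m H *m P - X^H *m (Q^H *m H' *m Q) *m X) *m invmx P.
  have PK : (invmx P)^H *m P^H = 1%:M by rewrite -conj_trM mulmxV // conj_tr1.
  rewrite mulmxBr mulmxBl !conj_trM !mulmxA PK mul1mx.
  by rewrite -(mulmxA H) mulmxV // mulmx1.
by apply/mx_ideal_powMr/mx_ideal_powMl.
Qed.

Lemma skew_congr m (H P : 'M[A]_m) : H^H = - H ->
  (P^H *m H *m P)^H = - (P^H *m H *m P).
Proof. by move=> sH; rewrite !conj_trM conj_trK sH mulNmx mulmxN mulmxA. Qed.

Lemma skew_diag m (H : 'M[A]_m) i : H^H = - H -> H i i \in r.
Proof. by move=> /matrixP/(_ i i); rewrite conj_trE mxE => /star_ramified. Qed.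

(** If every entry of the row lay in r, expansion along that row would put the determinant in r. *)
Lemma unitmx_row_unit m (H : 'M[A]_m) i : H \in unitmx ->
  exists j, H i j \is a GRing.unit.
Proof.
rewrite unitmxE => /(unit_notin r) rd; apply: contrapT => hN; case/negP: rd.
rewrite (expand_det_row _ i); apply: rpred_sum => j _; rewrite mulrC idealMr //.
by apply: contrapT => /negP/(local_unit r_local r_complete) u; apply: hN; exists j.
Qed.

(* [J] is the matrix [[0, 1], [-1, 0]]. *)
Let J : 'M[A]_2 := \matrix_(i, j) ((i < j)%:R - (j < i)%:R).

Lemma skew_block2 (K : 'M[A]_2) : K 0 0 \in r -> K 1 1 \in r -> K 0 1 = 1 ->
  K 1 0 = -1 -> mx_ideal_pow 1 (K - J).
Proof.
move=> K00 K11 K01 K10 i j; apply/ideal_pow1; rewrite !mxE.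
have I2 (k : 'I_2) : k = 0 \/ k = 1.
  by case: k => [[|[|//]]] hk; [left | right]; apply: val_inj.
case: (I2 i) (I2 j) => -> [] ->; rewrite ?K01 ?K10 /= ?subrr ?subr0 //.
  by rewrite subrr rpred0.
by rewrite sub0r subrr rpred0.
Qed.

(** A unit entry of row 0 is off the diagonal, since diagonal entries lie in r. Moving it to column
    1 and scaling it to 1 fixes the leading block modulo r. *)
Lemma skew_pivot n (H : 'M[A]_(2 + n)) : H^H = - H -> H \in unitmx ->
  exists2 P, P \in unitmx & mx_ideal_pow 1 (ulsubmx (P^H *m H *m P) - J).
Proof.
move=> sH uH; pose i0 : 'I_(2 + n) := lshift n 0; pose i1 : 'I_(2 + n) := lshift n 1.
have [j uj] := unitmx_row_unit i0 uH.
have j0 : j != i0.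
  by apply: contraTneq uj => ->; rewrite (unitE_local r_local r_complete) skew_diag.
pose s : {perm 'I_(2 + n)} := tperm i1 j.
(* Only the basis vector in position 1 is rescaled, so that the entry at [i0], [i1] becomes 1;
   skewness then gives -1 at [i1], [i0]. *)
pose d : 'rV[A]_(2 + n) := \row_k (if k == i1 then (H i0 j)^-1 else 1).
pose P : 'M[A]_(2 + n) := perm_mx s^-1 *m diag_mx d; exists P.
  rewrite unitmx_mul unitmx_perm unitmxE det_diag; apply: rpred_prod => k _.
  by rewrite mxE; case: ifP => _; rewrite ?unitrV ?unitr1.
have sP := skew_congr P sH; set M := _ *m P in sP *.
have ME a b : M a b = star (d 0 a) * H (s a) (s b) * d 0 b.
  have MP (X : 'M[A]_(2 + n)) a' b' : (X *m P) a' b' = X a' (s b') * d 0 b'.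
    by rewrite mulmxA -col_permE mul_mx_diag !mxE.
  rewrite /M MP -(conj_trK star (P^H *m H)) conj_trM conj_trK conj_trE MP.
  by rewrite rmorphM conj_trE /= (rmorphK star) [_ * star _]mulrC.
have M01 : M i0 i1 = 1.
  rewrite ME !mxE eqxx /= rmorph1 mul1r tpermL tpermD //.
  by rewrite mulrV.
have M10 : M i1 i0 = -1.
  move/matrixP/(_ i1 i0): sP; rewrite conj_trE M01 rmorph1 mxE => ->.
  by rewrite opprK.
clearbody M; have ulE k l : ulsubmx M k l = M (lshift n k) (lshift n l).
  by rewrite !mxE.
by apply: skew_block2; rewrite ulE ?M01 ?M10 // skew_diag.
Qed.

(** After pivoting, the leading block is invertible and splits off by block elimination. *)
Lemma skew_split n (H : 'M[A]_(2 + n)) : H^H = - H -> H \in unitmx ->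
  exists P K G, [/\ P \in unitmx, P^H *m H *m P = block_mx K 0 0 G,
    mx_ideal_pow 1 (K - J), G^H = - G & G \in unitmx].
Proof.
move=> sH uH; have [P uP] := skew_pivot sH uH.
have sM := skew_congr P sH.
have : P^H *m H *m P \in unitmx by rewrite !unitmx_mul conj_tr_unit uP uH.
have [M MP] : exists M, P^H *m H *m P = M by exists (P^H *m H *m P).
rewrite MP in sM *; move=> uM hK.
(* The leading block is congruent to [J], whose determinant is computed to be a unit. *)
have uK : ulsubmx M \in unitmx.
  rewrite (unitmx_mod r_local r_complete hK) unitmxE (expand_det_row _ ord0).
  rewrite big_ord_recl big_ord1 /cofactor !mxE /= !det_mx11 !mxE /=.
  rewrite !subr0 mul0r add0r mul1r sub0r mulrN1 unitrN.
  by rewrite unitrX // unitrN unitr1.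
(* [Y] is chosen so that the column operation [Q] clears the upper right block. *)
have [Y KY] : exists Y, ulsubmx M *m Y = - ursubmx M.
  by exists (- (invmx (ulsubmx M) *m ursubmx M)); rewrite mulmxN mulmxA mulmxV // mul1mx.
pose Q : 'M[A]_(2 + n) := block_mx 1%:M Y 0 1%:M.
have uQ : Q \in unitmx by rewrite unitmxE det_ublock !det1 mulr1 unitr1.
pose N := Q^H *m M *m Q; have sN : N^H = - N by apply: skew_congr.
have NE : N = block_mx (ulsubmx M) 0 (dlsubmx N) (drsubmx N).
  rewrite -[LHS]submxK; congr block_mx.
    rewrite /N /Q -{1}[M]submxK conj_tr_block !mulmx_block block_mxKul.
    by rewrite conj_tr1 conj_tr0 !mul0mx !mulmx0 !addr0 mul1mx mulmx1.
  rewrite /N /Q -{1}[M]submxK conj_tr_block !mulmx_block block_mxKur.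
  rewrite conj_tr1 conj_tr0 !mul0mx !addr0 !mul1mx !mulmx1.
  by rewrite KY addNr.
(* By skewness, the lower left block vanishes along with the upper right one. *)
have Ndl : dlsubmx N = 0.
  have : dlsubmx N^H = 0 by rewrite NE conj_tr_block block_mxKdl conj_tr0.
  rewrite sN => e; apply/eqP; rewrite -oppr_eq0 -[X in _ == X]e.
  by apply/eqP/matrixP => i j; rewrite !mxE.
rewrite Ndl in NE.
exists (P *m Q), (ulsubmx M), (drsubmx N).
have uN : N \in unitmx by rewrite !unitmx_mul conj_tr_unit uQ uM.
split.
- by rewrite unitmx_mul uP.
- by rewrite -NE /N -MP conj_trM !mulmxA.
- by [].
- have <- : drsubmx (- N) = - drsubmx N by apply/matrixP => i j; rewrite !mxE.
  by rewrite -sN /conj_tr -trmx_drsub map_drsubmx.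
by move: uN; rewrite {1}NE !unitmxE det_ublock unitrM => /andP[].
Qed.

(** Induction on the size, removing a block congruent to [J] from both matrices. Size 1 is
    impossible: the single entry would be both a unit and an element of r. *)
Lemma skew_congruent_mod m (H H' : 'M[A]_m) : H^H = - H -> H'^H = - H' ->
  H \in unitmx -> H' \in unitmx -> congruent_mod r star H H'.
Proof.
elim/ltn_ind: m H H' => -[|[|n]] IH H H' sH sH' uH uH'.
- by exists 1%:M; [exact: unitmx1 | case].
- have := skew_diag 0 sH; rewrite -[_ \in r]negbK -(unitE_local r_local r_complete).
  by rewrite -det_mx11 -unitmxE uH.
have [P [K [G [uP eP hK sG uG]]]] := @skew_split n H sH uH.
have [P' [K' [G' [uP' eP' hK' sG' uG']]]] := @skew_split n H' sH' uH'.
have [X uX hX] := IH n (leqnSn n.+1) G G' sG sG' uG uG'.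
apply: (congruent_mod_base uP uP'); rewrite eP eP'.
exists (block_mx 1%:M 0 0 X : 'M_(2 + n)).
  by rewrite unitmxE det_ublock det1 mul1r -unitmxE.
rewrite conj_tr_block !(conj_tr0, conj_tr1).
rewrite !mulmx_block !(mulmx0, mul0mx, addr0, add0r, mulmx1, mul1mx).
rewrite opp_block_mx add_block_mx !subr0.
have hKK : mx_ideal_pow 1 (K - K').
  have -> : K - K' = (K - J) - (K' - J) by rewrite opprB addrA subrK.
  exact/mx_ideal_powD/mx_ideal_powN.
move=> i j; case: (split_ordP i) => a ->; case: (split_ordP j) => b ->.
- by rewrite block_mxEul; apply: hKK.
- by rewrite block_mxEur mxE; apply: ideal_pow0.
- by rewrite block_mxEdl mxE; apply: ideal_pow0.
- by rewrite block_mxEdr; apply: hX.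
Qed.

End RamifiedSkew.

(** * Gram matrices in a standard basis, and equivalence of forms *)

Section FormMatrix.
Variables (A : comUnitRingType) (star : involutive_rmorphism A) (eps : A).
Variables (V : vectType A) (epsP : eps = 1 \/ eps = -1).

Local Notation "X ^H" := (conj_tr star X) (at level 1, format "X ^H").

Definition std_basis (i : 'I_(dim V)) : V := r2v (delta_mx 0 i).

Lemma std_basis_sum v : v = \sum_i v2r v 0 i *: std_basis i.
Proof.
apply: v2r_inj; rewrite linear_sum [LHS]row_sum_delta; apply: eq_bigr => i _.
by rewrite linearZ /= r2vK.
Qed.

Lemma std_basisP : is_basis std_basis.
Proof.
move=> v; exists (v2r v); split; first exact: std_basis_sum.
move=> a ->; rewrite linear_sum [RHS]row_sum_delta; apply: eq_bigr => i _.
by rewrite linearZ /= r2vK.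
Qed.

Definition coord_col (v : V) : 'cV[A]_(dim V) := (v2r v)^T.

Section OneForm.
Variable h : herm_form star eps V.

Lemma herm_star u v : star (h u v) = eps * h v u.
Proof. by rewrite (Defs.hermC (Defs.hermP h) u v) mulrA (eps_sqr epsP) mul1r. Qed.

Lemma herm_sumr u k (a : 'I_k -> A) (e : 'I_k -> V) :
  h u (\sum_i a i *: e i) = \sum_i h u (e i) * a i.
Proof.
elim/big_rec2: _ => [|i x y _ <-].
  by rewrite -(scale0r 0) (Defs.hermZr (Defs.hermP h)) mulr0.
by rewrite (Defs.hermDr (Defs.hermP h)) (Defs.hermZr (Defs.hermP h)).
Qed.

Lemma herm_suml v k (a : 'I_k -> A) (e : 'I_k -> V) :
  h (\sum_i a i *: e i) v = \sum_i star (a i) * h (e i) v.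
Proof.
rewrite (Defs.hermC (Defs.hermP h) v) herm_sumr rmorph_sum mulr_sumr.
apply: eq_bigr => i _; rewrite rmorphM /= herm_star.
by rewrite mulrA mulrA (eps_sqr epsP) mul1r mulrC.
Qed.

Lemma herm_matrixE u v :
  h u v = ((coord_col u)^H *m gram h std_basis *m coord_col v) 0 0.
Proof.
rewrite {1}(std_basis_sum v) herm_sumr mxE; apply: eq_bigr => j _.
rewrite [coord_col v _ _]mxE {1}(std_basis_sum u) herm_suml mxE; congr (_ * _).
by apply: eq_bigr => i _; rewrite !mxE.
Qed.

Lemma gram_herm k (e : 'I_k -> V) : (gram h e)^H = eps *: gram h e.
Proof. by apply/matrixP => i j; rewrite conj_trE !mxE herm_star. Qed.

End OneForm.

Variables h h' : herm_form star eps V.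

Lemma equivalent_of_gram X : X \in unitmx ->
  gram h std_basis = X^H *m gram h' std_basis *m X -> equivalent_forms h h'.
Proof.
move=> uX hX; pose f v : V := r2v (v2r v *m X^T).
have flin : linear f by move=> a u v; rewrite /f linearP mulmxDl -scalemxAl linearP.
pose phi : {linear V -> V} := HB.pack f (GRing.isLinear.Build A V V _ f flin).
exists phi.
  exists (fun v => r2v (v2r v *m (invmx X)^T)) => v; rewrite /= /f r2vK -mulmxA -trmx_mul.
    by rewrite mulVmx // trmx1 mulmx1 v2rK.
  by rewrite mulmxV // trmx1 mulmx1 v2rK.
have cf v : coord_col (f v) = X *m coord_col v.
  by rewrite /coord_col r2vK trmx_mul trmxK.
by move=> u v; rewrite !herm_matrixE hX /= !cf conj_trM !mulmxA.
Qed.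

Variable r : idealr A.
Hypotheses (r_local : local_ring r) (r_complete : adic_complete r).

Lemma red_form_lift : gram h std_basis \in unitmx ->
  equivalent_forms (red_form r h) (red_form r h') ->
  congruent_mod r star (gram h std_basis) (gram h' std_basis).
Proof.
move=> uH [phi _ hphi].
pose f j : V := repr (phi (red_pi r h (std_basis j))).
pose X := \matrix_(i, j) v2r (f j) 0 i.
suff hX : mx_ideal_pow r 1 (gram h std_basis - X^H *m gram h' std_basis *m X).
  by exists X => //; have [] := newton_unit r_local r_complete uH hX.
have XE : X^H *m gram h' std_basis *m X = \matrix_(i, j) h' (f i) (f j).
  have colE j : coord_col (f j) = col j X by apply/matrixP => i k; rewrite !mxE (ord1 k).
  apply/matrixP => i j; rewrite [RHS]mxE herm_matrixE !colE.
  have -> : (col i X)^H = row i X^H by apply/matrixP => k l; rewrite !mxE.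
  by rewrite -row_mul !mxE; apply: eq_bigr => k _; rewrite !mxE.
(* Modulo r both entries are values of the reduced forms, which [phi] matches. *)
move=> i j; apply/ideal_pow1; rewrite XE !mxE Quotient.idealrBE; apply/eqP.
by rewrite -(red_formE r_local) hphi -(red_formE r_local) /red_pi !reprK.
Qed.

End FormMatrix.

(** * Passage from an equivalence of forms to their reductions *)

Section Reduction.
Variables (A : comNzRingType) (star : involutive_rmorphism A) (eps : A).
Variables (V : lmodType A) (h h' : herm_form star eps V).
Variable r : idealr A.
Hypothesis (r_local : local_ring r).

(** An isometry and its inverse exchange the kernels V(1) of the two forms, so both descend to the
    quotients and remain mutually inverse there. *)
Lemma red_equivalent :
  equivalent_forms h h' -> equivalent_forms (red_form r h) (red_form r h').
Proof.
case=> phi [psi phiK psiK] hphi.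
have psi_form u v : h' u v = h (psi u) (psi v) by rewrite hphi !psiK.
have kphi v : v \in red_ker r h -> phi v \in red_ker r h'.
  by move=> /red_kerP hv; apply/red_kerP => u; rewrite psi_form phiK.
have kpsi v : v \in red_ker r h' -> psi v \in red_ker r h.
  by move=> /red_kerP hv; apply/red_kerP => u; rewrite hphi psiK.
have psiB u v : psi (u - v) = psi u - psi v.
  by rewrite -{1}[u]psiK -{1}[v]psiK -linearB phiK.
pose f (x : red_mod r h) : red_mod r h' := red_pi r h' (phi (repr x)).
pose g (x : red_mod r h') : red_mod r h := red_pi r h (psi (repr x)).
have fE v : f (red_pi r h v) = red_pi r h' (phi v).
  by apply/eqP; rewrite -Quotient.idealrBE -linearB kphi // Quotient.idealrBE reprK.
have gE v : g (red_pi r h' v) = red_pi r h (psi v).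
  by apply/eqP; rewrite -Quotient.idealrBE -psiB kpsi // Quotient.idealrBE reprK.
have flin : linear f.
  move=> a x y; rewrite -[a]reprK -[x]reprK -[y]reprK.
  rewrite -![_ *: _]/(red_scale _ _) red_scale_pi -raddfD !fE.
  by rewrite red_scale_pi /red_pi -raddfD linearP.
pose Phi : {linear red_mod r h -> red_mod r h'} :=
  HB.pack f (GRing.isLinear.Build _ _ _ _ f flin).
exists Phi.
  exists g => x; rewrite -[x]reprK /=.
    by rewrite fE gE phiK.
  by rewrite gE fE psiK.
move=> x y; rewrite -[x]reprK -[y]reprK /= !fE.
by rewrite !red_formE // hphi.
Qed.

End Reduction.

Theorem theorem2 (A : comUnitRingType) (r : idealr A)
    (star : involutive_rmorphism A) (V : vectType A) (eps : A)
    (h h' : herm_form star eps V) :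
  local_ring r -> adic_complete r -> (2%:R : A) \is a GRing.unit ->
  (0 < dim V)%N -> eps = 1 \/ eps = -1 ->
  nondegenerate_form h -> nondegenerate_form h' ->
  (equivalent_forms h h' <-> equivalent_forms (red_form r h) (red_form r h')) /\
  (ramified r star -> eps = -1 -> equivalent_forms h h').
Proof.
move=> rloc rcpl u2 _ epsP /(_ _ (@std_basisP A V)) uH /(_ _ (@std_basisP A V)) uH'.
have lift : congruent_mod r star (gram h (@std_basis A V)) (gram h' (@std_basis A V)) ->
    equivalent_forms h h'.
  move=> /(congruent_lift rloc rcpl u2 epsP (gram_herm epsP h _) (gram_herm epsP h' _) uH).
  by case=> X uX /equivalent_of_gram; apply.
split; first split=> [|/red_form_lift hred].
- exact: red_equivalent.
- exact/lift/hred.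
(* For [eps = -1] both Gram matrices are skew, hence congruent modulo r, and the congruence
   lifts. *)
move=> ram e1; apply/lift/skew_congruent_mod => //;
  by rewrite gram_herm // -scaleN1r -e1.
Qed.
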